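(* (Srivastava-Agarwal type generating functions for $\phi_n^{(\mathbf a,\mathbf b)}(x,y|q)$ and $\psi_n^{(\mathbf a,\mathbf b)}(x,y|q)$.) Let $|q|<1$. The following generating functions hold true: $$\sum_{n=0}^\infty(\lambda;q)_n\,\phi_n^{(\mathbf a,\mathbf b)}(x,y|q)\,\frac{t^n}{(q;q)_n}=\frac{(\lambda yt;q)_\infty}{(yt;q)_\infty}\;{}_{r+2}\Phi_{r+1}\!\left[\begin{matrix}a_1,a_2,\dots,a_{r+1},\,\lambda\\ b_1,b_2,\dots,b_r,\,\lambda yt\end{matrix};q;xt\right]\qquad(|yt|<1)$$ and $$\sum_{n=0}^\infty(\lambda;q)_n\,\psi_n^{(\mathbf a,\mathbf b)}(x,y|q)\,\frac{t^n}{(q;q)_n}=\frac{(\lambda yt;q)_\infty}{(yt;q)_\infty}\;{}_{r+2}\Phi_{r+1}\!\left[\begin{matrix}a_1,a_2,\dots,a_{r+1},\,\lambda\\ b_1,b_2,\dots,b_r,\,q/(yt)\end{matrix};q;\frac{xq}{y}\right]\qquad(|yt|<1).$$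
   Context: Notation: $(a;q)_0=1$, $(a;q)_n=\prod_{k=0}^{n-1}(1-aq^k)$, $(a;q)_\infty=\prod_{k=0}^\infty(1-aq^k)$, $(c_1,\dots,c_m;q)_n=(c_1;q)_n\cdots(c_m;q)_n$, and $\left[{n\atop k}\right]_q=\frac{(q;q)_n}{(q;q)_k(q;q)_{n-k}}$ is the $q$-binomial coefficient. Basic hypergeometric series: ${}_{r+2}\Phi_{r+1}\!\left[\begin{matrix}\alpha_1,\dots,\alpha_{r+2}\\ \beta_1,\dots,\beta_{r+1}\end{matrix};q;z\right]=\sum_{k\ge0}\frac{(\alpha_1,\dots,\alpha_{r+2};q)_k}{(\beta_1,\dots,\beta_{r+1};q)_k}\frac{z^k}{(q;q)_k}$. With parameters $\mathbf a=(a_1,\dots,a_{r+1})$ and $\mathbf b=(b_1,\dots,b_r)$, the two families of generalized Al-Salam-Carlitz $q$-polynomials are $$\phi_n^{(\mathbf a,\mathbf b)}(x,y|q)=\sum_{k=0}^n\left[{n\atop k}\right]_q\frac{(a_1,\dots,a_{r+1};q)_k}{(b_1,\dots,b_r;q)_k}\,x^ky^{n-k},$$ $$\psi_n^{(\mathbf a,\mathbf b)}(x,y|q)=\sum_{k=0}^n\left[{n\atop k}\right]_q\frac{(a_1,\dots,a_{r+1};q)_k}{(b_1,\dots,b_r;q)_k}\,(-1)^kq^{\binom{k+1}2-nk}\,x^ky^{n-k}.$$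
   Formalization: The second identity fails for general |yt|<1 (e.g. r=0, a_1=0, x=y); it is proved as formal power series in t, and for |yt|<1 when the double series from inserting psi_n converges absolutely. Nonzero denominators, and convergence of Phi in the first identity, are assumed. *)

(* Defs.v *)
(* Library world: Stdlib reals with Coquelicot (complex numbers C). *)
From Stdlib Require Import Reals List Arith.
From Coquelicot Require Import Coquelicot.
Import ListNotations.
Open Scope C_scope.

Fixpoint qpoch (a q : C) (n : nat) : C :=
  match n with
  | O => 1
  | S k => qpoch a q k * (1 - a * q ^ k)
  end.

(* The limit of the partial products, taken componentwise; for |q| < 1 the
   partial products converge for every a. *)
Definition qpoch_inf (a q : C) : C :=
  (real (Lim_seq (fun n => Re (qpoch a q n))),
   real (Lim_seq (fun n => Im (qpoch a q n)))).

Definition qpochs (cs : list C) (q : C) (n : nat) : C :=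
  fold_right Cmult 1 (map (fun c => qpoch c q n) cs).

Definition qbinom (q : C) (n k : nat) : C :=
  qpoch q q n / (qpoch q q k * qpoch q q (n - k)).

(* Sum of a complex series, taken componentwise; only meaningful for convergent
   series. *)
Definition CSeries (u : nat -> C) : C :=
  (Series (fun n => Re (u n)), Series (fun n => Im (u n))).

Definition hyp_term (alphas betas : list C) (q z : C) (k : nat) : C :=
  qpochs alphas q k / qpochs betas q k * (z ^ k / qpoch q q k).

Definition hyp_Phi (alphas betas : list C) (q z : C) : C :=
  CSeries (hyp_term alphas betas q z).

(* No (beta; q)_k vanishes, so that a parameter beta is admissible in a
   denominator. *)
Definition admissible (q beta : C) : Prop :=
  forall k : nat, qpoch beta q k <> 0.

Definition phi (a b : list C) (n : nat) (x y q : C) : C :=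
  sum_n (fun k => qbinom q n k * (qpochs a q k / qpochs b q k)
                  * (x ^ k * y ^ (n - k))) n.

(* The exponent binom(k+1,2) - nk may be negative, so the power of q is written
   as a quotient; q is nonzero wherever psi is used. *)
Definition psi_term (a b : list C) (n : nat) (x y q : C) (k : nat) : C :=
  qbinom q n k * (qpochs a q k / qpochs b q k)
  * ((- (1)) ^ k * (q ^ (k * (k + 1) / 2) / q ^ (n * k)))
  * (x ^ k * y ^ (n - k)).

Definition psi (a b : list C) (n : nat) (x y q : C) : C :=
  sum_n (psi_term a b n x y q) n.

(* c is the sequence of coefficients of the power series expansion of f at 0;
   f itself may be undefined (junk-valued) at 0. *)
Definition expands_at_0 (f : C -> C) (c : nat -> C) : Prop :=
  exists r : R, (0 < r)%R /\
    forall t : C, t <> 0 -> (Cmod t < r)%R ->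
      is_series (fun n => c n * t ^ n) (f t).

(* The identity  sum_n c_n t^n = sum_k F_k(t)  of formal power series in t:
   each F_k is replaced by its expansion u_k at 0, which is divisible by t^k, so
   that the sum over k converges t-adically and only k <= n contribute to the
   coefficient of t^n.  No convergence of either side at a value of t is
   involved. *)
Definition formal_sum_eq (c : nat -> C) (F : nat -> C -> C) : Prop :=
  exists u : nat -> nat -> C,
    (forall k, expands_at_0 (F k) (u k)) /\
    (forall k n, (n < k)%nat -> u k n = 0) /\
    (forall n, c n = sum_n (fun k => u k n) n).

(* Main.v *)
Require Import Defs.
From Stdlib Require Import Reals List Arith Lra Lia Classical.
From Coquelicot Require Import Coquelicot.
Import ListNotations.
Open Scope C_scope.

(** Inserting the definition of the polynomials turns the left-hand side into a
    double series over k <= n, and the theorem amounts to summing it over n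
    first.  Put n = k + m.  Since (lambda)_n = (lambda)_k (lambda q^k)_m and the
    q-binomial coefficient cancels (q)_n, row k is a factor that does not depend
    on m times the series
      sum_m (lambda q^k)_m / (q)_m z^m,
    with z = y t for phi; for psi the factor q^(-nk) leaves q^(-km), so that
    z = y t / q^k ([row_term], [psi_term_eq]).  The q-binomial theorem
    ([q_binomial]) evaluates this series as (lambda q^k z)_oo / (z)_oo, and
    splitting off the first k factors of an infinite product gives the k-th
    hypergeometric term times (lambda y t)_oo / (y t)_oo: for phi,
      (lambda y t q^k)_oo = (lambda y t)_oo / (lambda y t)_k,
    and for psi,
      (y t / q^k)_oo = (y t / q^k)_k (y t)_oo,
    where reversing the finite product produces (q / (y t))_k
    ([phi_row_value], [psi_row_value]).

    What remains is the interchange of the two summations, [triangle_by_rows],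
    which needs absolute convergence of the double series.  For phi it follows
    from the convergence of the hypergeometric series, because such a series
    converges only if it converges absolutely ([hyp_term_abs]).  For psi it is
    assumed in the analytic statement; there y t / q^k leaves the unit disc as k
    grows, so a row with a nonzero factor can converge only when it terminates,
    and the q-binomial theorem is proved in a form that includes this case.  In
    the formal statement no interchange is needed: each row is the expansion of
    one hypergeometric term near t = 0. *)

(** * Limits and series of complex numbers *)

(** Reducing a complex limit to a real one makes the squeeze principle available. *)
Definition Clim (u : nat -> C) (l : C) : Prop :=
  is_lim_seq (fun n => Cmod (u n - l)) 0.

Lemma filterlim_norm {K : AbsRing} {V : NormedModule K} (u : nat -> V) (l : V) :
  filterlim u eventually (locally l) <->
  is_lim_seq (fun n => norm (minus (u n) l)) 0.
Proof.
  rewrite filterlim_locally_ball_norm, <- is_lim_seq_spec.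
  unfold is_lim_seq', ball_norm.
  split; intros H eps; generalize (H eps); apply filter_imp; intros x;
    rewrite Rminus_0_r, Rabs_pos_eq; auto; apply norm_ge_0.
Qed.

Lemma is_series_Clim (u : nat -> C) (l : C) :
  is_series u l <-> Clim (sum_n u) l.
Proof. apply (@filterlim_norm C_AbsRing C_NormedModule). Qed.

Lemma Clim_squeeze (u : nat -> C) (l : C) (v : nat -> R) :
  (forall n, (Cmod (u n - l) <= v n)%R) -> is_lim_seq v 0 -> Clim u l.
Proof.
  intros H Hv.
  apply (is_lim_seq_le_le (fun _ => 0%R) _ v); auto.
  - intros n; split; [apply Cmod_ge_0 | apply H].
  - apply is_lim_seq_const.
Qed.

Lemma Clim_const (l : C) : Clim (fun _ => l) l.
Proof.
  apply Clim_squeeze with (fun _ => 0%R); [|apply is_lim_seq_const].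
  intros _; replace (l - l) with (RtoC 0) by ring; rewrite Cmod_0; lra.
Qed.

Lemma Clim_minus (u v : nat -> C) (l m : C) :
  Clim u l -> Clim v m -> Clim (fun n => u n - v n) (l - m).
Proof.
  intros Hu Hv.
  apply Clim_squeeze with (fun n => (Cmod (u n - l) + Cmod (v n - m))%R).
  - intros n.
    replace (u n - v n - (l - m)) with ((u n - l) + - (v n - m)) by ring.
    eapply Rle_trans; [apply Cmod_triangle|rewrite Cmod_opp; lra].
  - replace 0%R with (0 + 0)%R by ring. apply is_lim_seq_plus'; assumption.
Qed.

Lemma Clim_mult (u v : nat -> C) (l m : C) :
  Clim u l -> Clim v m -> Clim (fun n => u n * v n) (l * m).
Proof.
  intros Hu Hv.
  apply Clim_squeeze with
    (fun n => (Cmod (u n - l) * Cmod (v n - m) + Cmod m * Cmod (u n - l)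
               + Cmod l * Cmod (v n - m))%R).
  - intros n.
    replace (u n * v n - l * m)
      with ((u n - l) * (v n - m) + m * (u n - l) + l * (v n - m)) by ring.
    rewrite <- !Cmod_mult.
    eapply Rle_trans; [apply Cmod_triangle|].
    apply Rplus_le_compat_r, Cmod_triangle.
  - replace 0%R with (0 * 0 + Cmod m * 0 + Cmod l * 0)%R by ring.
    repeat apply is_lim_seq_plus'; repeat apply is_lim_seq_mult';
      try assumption; apply is_lim_seq_const.
Qed.

Lemma Clim_unique (u : nat -> C) (l m : C) : Clim u l -> Clim u m -> l = m.
Proof.
  intros Hl Hm.
  generalize (Clim_minus _ _ _ _ Hl Hm); intros H.
  assert (E : Cmod (l - m) = 0%R).
  { apply (is_lim_seq_unique _ _) in H.
    rewrite (Lim_seq_ext _ (fun _ => Cmod (l - m))), Lim_seq_const in H.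
    - injection H; auto.
    - intros n; rewrite <- Cmod_opp; f_equal; ring. }
  apply Cmod_eq_0 in E.
  replace l with (l - m + m) by ring; rewrite E; ring.
Qed.

Lemma Clim_lower_bound (u : nat -> C) (l : C) (c : R) :
  Clim u l -> (0 < c)%R -> (forall n, (c <= Cmod (u n))%R) -> l <> 0.
Proof.
  intros H Hc Hu E; subst l.
  assert (Rbar_le c 0).
  { apply (is_lim_seq_le (fun _ => c) (fun n => Cmod (u n - 0))); auto.
    - intros n; replace (u n - 0) with (u n) by ring; apply Hu.
    - apply is_lim_seq_const. }
  simpl in *; lra.
Qed.

(** Both [qpoch_inf] and [CSeries] are built from componentwise limits; this is
    what gives them their values. *)
Lemma Clim_components (u : nat -> C) (l : C) :
  Clim u l ->
  Lim_seq (fun n => Re (u n)) = Re l /\ Lim_seq (fun n => Im (u n)) = Im l.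
Proof.
  intros H.
  split; apply is_lim_seq_unique.
  - apply (is_lim_seq_ext (fun n => (Re (u n - l) + Re l)%R)).
    { intros n; unfold Cminus; rewrite re_plus, re_opp; ring. }
    replace (Finite (Re l)) with (Finite (0 + Re l)%R) by (f_equal; ring).
    apply is_lim_seq_plus'; [|apply is_lim_seq_const].
    apply is_lim_seq_abs_0.
    apply (is_lim_seq_le_le (fun _ => 0%R) _ (fun n => Cmod (u n - l))); auto.
    + intros n; split; [apply Rabs_pos | apply re_le_Cmod].
    + apply is_lim_seq_const.
  - apply (is_lim_seq_ext (fun n => (Im (u n - l) + Im l)%R)).
    { intros n; unfold Cminus; rewrite im_plus, im_opp; ring. }
    replace (Finite (Im l)) with (Finite (0 + Im l)%R) by (f_equal; ring).
    apply is_lim_seq_plus'; [|apply is_lim_seq_const].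
    apply is_lim_seq_abs_0.
    apply (is_lim_seq_le_le (fun _ => 0%R) _ (fun n => Cmod (u n - l))); auto.
    + intros n; split; [apply Rabs_pos | ].
      eapply Rle_trans; [apply Rmax_r | apply Rmax_Cmod].
    + apply is_lim_seq_const.
Qed.

Lemma is_series_C_unique (u : nat -> C) (l m : C) :
  is_series u l -> is_series u m -> l = m.
Proof. rewrite !is_series_Clim; apply Clim_unique. Qed.

Lemma is_series_C_ext (u v : nat -> C) (l : C) :
  (forall n, u n = v n) -> is_series u l -> is_series v l.
Proof. apply (is_series_ext (V := C_NormedModule)). Qed.

Lemma is_series_C_scal (c : C) (u : nat -> C) (l : C) :
  is_series u l -> is_series (fun n => c * u n) (c * l).
Proof. apply (is_series_scal (V := C_NormedModule) c u l). Qed.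

Lemma is_series_C_minus (u v : nat -> C) (l m : C) :
  is_series u l -> is_series v m -> is_series (fun n => u n - v n) (l - m).
Proof. apply (is_series_minus (V := C_NormedModule) u v l m). Qed.

Lemma ex_series_Cmod_le (u : nat -> C) (v : nat -> R) :
  (forall n, (Cmod (u n) <= v n)%R) -> ex_series v -> ex_series u.
Proof. apply (@ex_series_le C_AbsRing C_CompleteNormedModule). Qed.

Lemma ex_series_R_le (u v : nat -> R) :
  (forall n, (0 <= u n <= v n)%R) -> ex_series v -> ex_series u.
Proof.
  intros H; apply (@ex_series_le R_AbsRing R_CompleteNormedModule).
  intros n; change (Rabs (u n) <= v n)%R.
  rewrite Rabs_pos_eq; apply H.
Qed.

Lemma Re_sum_n (u : nat -> C) (n : nat) :
  Re (sum_n u n) = sum_n (fun k => Re (u k)) n.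
Proof.
  induction n; [now rewrite !sum_O | rewrite !sum_Sn, <- IHn; reflexivity].
Qed.

Lemma Im_sum_n (u : nat -> C) (n : nat) :
  Im (sum_n u n) = sum_n (fun k => Im (u k)) n.
Proof.
  induction n; [now rewrite !sum_O | rewrite !sum_Sn, <- IHn; reflexivity].
Qed.

Lemma CSeries_unique (u : nat -> C) (l : C) : is_series u l -> CSeries u = l.
Proof.
  rewrite is_series_Clim; intros H.
  destruct (Clim_components _ _ H) as [Hr Hi].
  unfold CSeries, Series.
  rewrite <- (Lim_seq_ext _ _ (Re_sum_n u)), <- (Lim_seq_ext _ _ (Im_sum_n u)).
  rewrite Hr, Hi; symmetry; apply surjective_pairing.
Qed.

Lemma Cmod_sum_n_m (u : nat -> C) (n m : nat) :
  (Cmod (sum_n_m u n m) <= sum_n_m (fun k => Cmod (u k)) n m)%R.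
Proof. apply (norm_sum_n_m (V := C_NormedModule)). Qed.

Lemma sum_n_Cmod_ge_0 (u : nat -> C) (n : nat) :
  (0 <= sum_n (fun k => Cmod (u k)) n)%R.
Proof.
  eapply Rle_trans; [apply (Cmod_ge_0 (sum_n_m u 0 n))|apply Cmod_sum_n_m].
Qed.

Lemma Cmod_le_sum_n (u : nat -> C) (k n : nat) :
  (k <= n)%nat -> (Cmod (u k) <= sum_n (fun j => Cmod (u j)) n)%R.
Proof.
  intros Hk; induction Hk as [|n Hk IH].
  - destruct k; [rewrite sum_O; lra|].
    rewrite sum_Sn; generalize (sum_n_Cmod_ge_0 u k).
    change plus with Rplus; lra.
  - rewrite sum_Sn; generalize (Cmod_ge_0 (u (S n))).
    change plus with Rplus; lra.
Qed.

Lemma is_series_Cmod_le (u : nat -> C) (l : C) (v : nat -> R) (L : R) :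
  (forall n, (Cmod (u n) <= v n)%R) -> is_series u l -> is_series v L ->
  (Cmod l <= L)%R.
Proof.
  intros Huv Hu Hv.
  rewrite is_series_Clim in Hu.
  assert (Rbar_le (Cmod l) (0 + L)%R).
  { apply (is_lim_seq_le (fun _ => Cmod l)
             (fun n => (Cmod (sum_n u n - l) + sum_n v n)%R)).
    - intros n.
      replace l with (- (sum_n u n - l) + sum_n u n) at 1 by ring.
      eapply Rle_trans; [apply Cmod_triangle|rewrite Cmod_opp].
      apply Rplus_le_compat_l.
      eapply Rle_trans; [apply Cmod_sum_n_m|].
      now apply sum_n_m_le.
    - apply is_lim_seq_const.
    - apply is_lim_seq_plus'; assumption. }
  simpl in *; lra.
Qed.

Lemma is_series_tail {K : AbsRing} {V : NormedModule K} (a : nat -> V) (l : V)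
    (N : nat) :
  is_series a l -> is_series (fun n => a (S N + n)%nat) (minus l (sum_n a N)).
Proof.
  intros H; apply is_series_incr_n; [lia|].
  refine (eq_ind l (fun l' => is_series a l') H _ _).
  change (l = plus (plus l (opp (sum_n a N))) (sum_n a N)).
  transitivity (plus l (plus (opp (sum_n a N)) (sum_n a N)));
    [|apply plus_assoc].
  transitivity (plus l zero); [symmetry; apply plus_zero_r|].
  apply f_equal; symmetry; apply (plus_opp_l (sum_n a N)).
Qed.

(** Row k of the double series starts at index k, while the q-binomial theorem
    sums it from 0. *)
Lemma is_series_delay (a : nat -> C) (l : C) (k : nat) :
  (forall n, (n < k)%nat -> a n = 0) ->
  is_series (fun m => a (k + m)%nat) l -> is_series a l.
Proof.
  intros Ha H; destruct k as [|k]; [exact H|].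
  apply (is_series_decr_n (V := C_NormedModule)) with (S k); [lia|].
  refine (eq_ind l (is_series (fun m => a (S k + m)%nat)) H _ _).
  change (l = l - sum_n a k).
  replace (sum_n a k) with (RtoC 0); [ring|].
  rewrite (sum_n_ext_loc _ (fun _ => RtoC 0)).
  - symmetry; apply (sum_n_m_const_zero (G := C_AbelianMonoid)).
  - intros n Hn; apply Ha; lia.
Qed.

Lemma series_terms_lim_0 (u : nat -> C) : ex_series u -> Clim u 0.
Proof.
  intros [l H]; rewrite is_series_Clim in H.
  assert (H1 : Clim (fun n => sum_n u (S n)) l).
  { apply (is_lim_seq_incr_1 (fun n => Cmod (sum_n u n - l))); exact H. }
  generalize (Clim_minus _ _ _ _ H1 H); intros H2.
  apply (is_lim_seq_incr_1 (fun n => Cmod (u n - 0))).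
  eapply is_lim_seq_ext; [|exact H2].
  intros n; simpl; f_equal; rewrite sum_Sn.
  change (sum_n u n + u (S n) - sum_n u n - (l - l) = u (S n) - 0); ring.
Qed.

(** * Summing a triangular array by rows *)

Lemma sum_n_extend (u : nat -> C) (n N : nat) :
  (n <= N)%nat -> (forall k, (n < k)%nat -> u k = 0) -> sum_n u N = sum_n u n.
Proof.
  intros HN Hu; induction HN as [|N HN IH]; [reflexivity|].
  rewrite sum_Sn, IH, Hu by lia.
  change (sum_n u n + 0 = sum_n u n); ring.
Qed.

Lemma sum_n_is_series (d : nat -> nat -> C) (R : nat -> C) (N : nat) :
  (forall k, is_series (d k) (R k)) ->
  is_series (fun n => sum_n (fun k => d k n) N) (sum_n R N).
Proof.
  intros H; induction N as [|N IH].
  - rewrite sum_O; eapply is_series_C_ext; [|apply (H O)].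
    intros n; now rewrite sum_O.
  - rewrite sum_Sn.
    refine (is_series_ext (V := C_NormedModule) _ _ _ _
              (is_series_plus (V := C_NormedModule) _ _ _ _ IH (H (S N)))).
    intros n; symmetry; apply sum_Sn.
Qed.

(** Fubini for a triangular array.  After the first N + 1 rows are removed, the
    array vanishes in all columns up to N, and in a later column what is left is
    dominated by the absolute column sum.  The error is therefore at most a tail
    of the series of absolute column sums. *)
Lemma triangle_by_rows (d : nat -> nat -> C) (R : nat -> C) :
  (forall k n, (n < k)%nat -> d k n = 0) ->
  ex_series (fun n => sum_n (fun k => Cmod (d k n)) n) ->
  (forall k, is_series (d k) (R k)) ->
  exists S, is_series (fun n => sum_n (fun k => d k n) n) S /\ is_series R S.
Proof.
  intros Hd [L HL] HR.
  destruct (ex_series_Cmod_le (fun n => sum_n (fun k => d k n) n) _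
              (fun n => Cmod_sum_n_m _ 0 n) (ex_intro _ L HL)) as [S HS].
  exists S; split; [exact HS|].
  apply is_series_Clim.
  apply Clim_squeeze with
    (fun N => (L - sum_n (fun n => sum_n (fun k => Cmod (d k n)) n) N)%R).
  - intros N.
    rewrite <- Cmod_opp.
    generalize (is_series_C_minus _ _ _ _ HS (sum_n_is_series d R N HR)).
    set (e := fun n => sum_n (fun k => d k n) n - sum_n (fun k => d k n) N).
    intros He.
    assert (He0 : forall n, (n <= N)%nat -> e n = 0).
    { intros n Hn; unfold e.
      rewrite (sum_n_extend _ n N Hn); [ring|].
      intros k Hk; apply Hd, Hk. }
    replace (- (sum_n R N - S)) with (minus (S - sum_n R N) (sum_n e N)).
    2:{ unfold sum_n at 2. rewrite (sum_n_m_ext_loc _ (fun _ => RtoC 0)).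
        - replace (sum_n_m (fun _ => RtoC 0) 0 N) with (RtoC 0).
          + change (S - sum_n R N - 0 = - (sum_n R N - S)); ring.
          + symmetry; apply (sum_n_m_const_zero (G := C_AbelianMonoid)).
        - intros k Hk; apply He0; lia. }
    refine (is_series_Cmod_le _ _ _ _ _
              (is_series_tail (V := C_NormedModule) _ _ N He)
              (is_series_tail (V := R_NormedModule) _ _ N HL)).
    intros n; unfold e; set (m := (Datatypes.S N + n)%nat).
    replace (sum_n (fun k => d k m) m - sum_n (fun k => d k m) N)
      with (sum_n_m (fun k => d k m) (Datatypes.S N) m)
      by (apply (sum_n_m_sum_n (G := C_AbelianGroup)); unfold m; lia).
    eapply Rle_trans; [apply Cmod_sum_n_m|].
    unfold sum_n at 1; rewrite (sum_n_m_Chasles _ 0 N m) by (unfold m; lia).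
    change (sum_n_m (fun k => Cmod (d k m)) (Datatypes.S N) m
            <= sum_n_m (fun k => Cmod (d k m)) 0 N
               + sum_n_m (fun k => Cmod (d k m)) (Datatypes.S N) m)%R.
    generalize (sum_n_Cmod_ge_0 (fun k => d k m) N); unfold sum_n; lra.
  - replace 0%R with (L - L)%R by ring.
    apply is_lim_seq_minus'; [apply is_lim_seq_const|exact HL].
Qed.

Definition triangle (w : nat -> C) (T : nat -> nat -> C) (k n : nat) : C :=
  if (k <=? n)%nat then w n * T n k else 0.

Lemma triangle_lt w T k n : (n < k)%nat -> triangle w T k n = 0.
Proof.
  intros H; unfold triangle; destruct (Nat.leb_spec k n); [lia|reflexivity].
Qed.

Lemma triangle_ge w T k n : (k <= n)%nat -> triangle w T k n = w n * T n k.
Proof.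
  intros H; unfold triangle; destruct (Nat.leb_spec k n); [reflexivity|lia].
Qed.

Lemma sum_triangle (w : nat -> C) (T : nat -> nat -> C) (n : nat) :
  sum_n (fun k => triangle w T k n) n = w n * sum_n (T n) n.
Proof.
  rewrite (sum_n_ext_loc _ (fun k => w n * T n k))
    by (intros; now apply triangle_ge).
  apply (sum_n_mult_l (K := C_Ring)).
Qed.

Lemma sum_Cmod_triangle (w : nat -> C) (T : nat -> nat -> C) (n : nat) :
  sum_n (fun k => Cmod (triangle w T k n)) n
  = (Cmod (w n) * sum_n (fun k => Cmod (T n k)) n)%R.
Proof.
  rewrite (sum_n_ext_loc _ (fun k => Cmod (w n) * Cmod (T n k))%R).
  - apply (sum_n_mult_l (K := R_Ring)).
  - intros k Hk; rewrite triangle_ge by assumption; apply Cmod_mult.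
Qed.

Lemma ex_series_row (d : nat -> nat -> C) (k : nat) :
  (forall k n, (n < k)%nat -> d k n = 0) ->
  ex_series (fun n => sum_n (fun k => Cmod (d k n)) n) ->
  ex_series (fun n => Cmod (d k n)).
Proof.
  intros Hd; apply ex_series_R_le; intros n; split; [apply Cmod_ge_0|].
  destruct (Nat.le_gt_cases k n) as [Hk|Hk].
  - now apply (Cmod_le_sum_n (fun j => d j n)).
  - rewrite Hd, Cmod_0 by assumption; apply sum_n_Cmod_ge_0.
Qed.

(** * q-shifted factorials and their infinite products *)

Lemma qpoch_add (a q : C) (k n : nat) :
  qpoch a q (k + n) = qpoch a q k * qpoch (a * q ^ k) q n.
Proof.
  induction n as [|n IH]; [rewrite Nat.add_0_r; simpl; ring|].
  rewrite Nat.add_succ_r; simpl; rewrite IH, Cpow_add_r; ring.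
Qed.

Lemma qpoch_S_front (a q : C) (n : nat) :
  qpoch a q (S n) = (1 - a) * qpoch (a * q) q n.
Proof.
  change (S n) with (1 + n)%nat; rewrite qpoch_add, Cpow_1_r; simpl; ring.
Qed.

Lemma Cmod_pow_le_1 (q : C) (n : nat) : (Cmod q < 1)%R -> (Cmod (q ^ n) <= 1)%R.
Proof.
  intros Hq; rewrite Cmod_pow.
  rewrite <- (pow1 n); apply pow_incr; split; [apply Cmod_ge_0|lra].
Qed.

Lemma Cmod_one_minus_le (z : C) : (Cmod (1 - z) <= 1 + Cmod z)%R.
Proof.
  unfold Cminus; eapply Rle_trans; [apply Cmod_triangle|].
  rewrite Cmod_opp, Cmod_1; lra.
Qed.

Lemma Cmod_one_minus_ge (z : C) : (1 - Cmod z <= Cmod (1 - z))%R.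
Proof.
  generalize (Cmod_triangle (1 - z) z).
  replace (1 - z + z) with (RtoC 1) by ring; rewrite Cmod_1; lra.
Qed.

(** A bound that is uniform in a: the parameter will be lambda q^k, with k
    ranging over all rows.  It comes from 1 + u <= exp u and the geometric sum. *)
Lemma qpoch_bounded (q : C) (A : R) :
  (Cmod q < 1)%R ->
  exists M, (0 < M)%R /\
    forall a n, (Cmod a <= A)%R -> (Cmod (qpoch a q n) <= M)%R.
Proof.
  intros Hq.
  pose proof (Cmod_ge_0 q) as Hq0.
  exists (exp (A / (1 - Cmod q))); split; [apply exp_pos|].
  intros a n Ha.
  pose proof (Cmod_ge_0 a) as Ha0.
  assert (H : (Cmod (qpoch a q n) <= exp (A * (1 - Cmod q ^ n) / (1 - Cmod q)))%R).
  { induction n as [|n IH].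
    - simpl; rewrite Cmod_1.
      replace (A * (1 - 1) / (1 - Cmod q))%R with 0%R by (field; lra).
      rewrite exp_0; lra.
    - simpl qpoch; rewrite Cmod_mult.
      replace (A * (1 - Cmod q ^ S n) / (1 - Cmod q))%R
        with (A * (1 - Cmod q ^ n) / (1 - Cmod q) + A * Cmod q ^ n)%R
        by (simpl; field; lra).
      rewrite exp_plus.
      apply Rmult_le_compat; auto using Cmod_ge_0.
      eapply Rle_trans; [apply Cmod_one_minus_le|].
      eapply Rle_trans; [|apply exp_ineq1_le].
      rewrite Cmod_mult, Cmod_pow.
      assert (0 <= Cmod q ^ n)%R by now apply pow_le.
      nra. }
  eapply Rle_trans; [exact H|].
  assert (0 <= Cmod q ^ n)%R by now apply pow_le.
  destruct (Rle_lt_or_eq_dec (A * (1 - Cmod q ^ n) / (1 - Cmod q)) (A / (1 - Cmod q)))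
    as [Hlt|Heq].
  - unfold Rdiv; apply Rmult_le_compat_r; [|nra].
    left; apply Rinv_0_lt_compat; lra.
  - left; now apply exp_increasing.
  - rewrite Heq; lra.
Qed.

Lemma ex_series_geom_scal (c x : R) :
  (0 <= x < 1)%R -> ex_series (fun n => (c * x ^ n)%R).
Proof.
  intros Hx; exists (c * / (1 - x))%R.
  apply (is_series_scal (V := R_NormedModule) c).
  apply is_series_geom; rewrite Rabs_pos_eq; lra.
Qed.

(** The increments of the partial products are a q^n times a bounded factor, so
    they are absolutely summable. *)
Lemma qpoch_inf_lim (a q : C) :
  (Cmod q < 1)%R -> Clim (qpoch a q) (qpoch_inf a q).
Proof.
  intros Hq.
  destruct (qpoch_bounded q (Cmod a) Hq) as [M [HM Hb]].
  assert (E : exists l, Clim (qpoch a q) l).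
  { destruct (ex_series_Cmod_le (fun n => qpoch a q n * (a * q ^ n))
                (fun n => (M * Cmod a * Cmod q ^ n)%R)) as [l Hl].
    - intros n; rewrite !Cmod_mult, Cmod_pow, Rmult_assoc.
      apply Rmult_le_compat_r; [|apply Hb; lra].
      apply Rmult_le_pos; [apply Cmod_ge_0|apply pow_le, Cmod_ge_0].
    - apply ex_series_geom_scal; split; [apply Cmod_ge_0|exact Hq].
    - exists (1 - l).
      apply (is_lim_seq_incr_1 (fun n => Cmod (qpoch a q n - (1 - l)))).
      rewrite is_series_Clim in Hl.
      eapply is_lim_seq_ext; [|apply (Clim_minus _ _ _ _ (Clim_const 1) Hl)].
      intros n; simpl; f_equal.
      assert (Hs : sum_n (fun n => qpoch a q n * (a * q ^ n)) n = 1 - qpoch a q (S n)).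
      { clear; induction n as [|n IH].
        - rewrite sum_O; simpl; ring.
        - rewrite sum_Sn, IH; change plus with Cplus; simpl; ring. }
      rewrite Hs; simpl; ring. }
  destruct E as [l Hl].
  destruct (Clim_components _ _ Hl) as [Hr Hi].
  replace (qpoch_inf a q) with l; [exact Hl|].
  unfold qpoch_inf; rewrite Hr, Hi; apply surjective_pairing.
Qed.

(** The Weierstrass inequality: a product of factors 1 - u_j, with u_j in [0, 1],
    is at least 1 minus the sum of the u_j. *)
Lemma qpoch_ge (a q : C) (n : nat) :
  (Cmod q < 1)%R -> (Cmod a <= 1 - Cmod q)%R ->
  (1 - Cmod a * (1 - Cmod q ^ n) / (1 - Cmod q) <= Cmod (qpoch a q n))%R.
Proof.
  intros Hq Ha.
  pose proof (Cmod_ge_0 q) as Hq0; pose proof (Cmod_ge_0 a) as Ha0.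
  induction n as [|n IH].
  - simpl; rewrite Cmod_1, Rminus_diag, Rmult_0_r; unfold Rdiv; lra.
  - simpl qpoch; rewrite Cmod_mult.
    pose proof (Cmod_one_minus_ge (a * q ^ n)) as H1.
    rewrite Cmod_mult, Cmod_pow in H1.
    replace (Cmod a * (1 - Cmod q ^ S n) / (1 - Cmod q))%R
      with (Cmod a * (1 - Cmod q ^ n) / (1 - Cmod q) + Cmod a * Cmod q ^ n)%R
      by (simpl; field; lra).
    assert (Hp : (0 <= Cmod q ^ n <= 1)%R).
    { split; [now apply pow_le|].
      rewrite <- (pow1 n); apply pow_incr; lra. }
    set (s := (Cmod a * (1 - Cmod q ^ n) / (1 - Cmod q))%R) in *.
    assert (Hs : (0 <= s <= 1)%R).
    { assert (s * (1 - Cmod q) = Cmod a * (1 - Cmod q ^ n))%R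
        by (unfold s; field; lra).
      split; nra. }
    set (u := (Cmod a * Cmod q ^ n)%R) in *.
    assert (Hu : (0 <= u <= 1)%R) by (unfold u; split; nra).
    apply Rle_trans with ((1 - s) * (1 - u))%R; [nra|].
    apply Rmult_le_compat; lra.
Qed.

Lemma pow_eventually_small (x e : R) :
  (0 <= x < 1)%R -> (0 < e)%R -> exists N, forall n, (N <= n)%nat -> (x ^ n <= e)%R.
Proof.
  intros Hx He.
  destruct (pow_lt_1_zero x) with e as [N HN]; [rewrite Rabs_pos_eq; lra|lra|].
  exists N; intros n Hn.
  specialize (HN n Hn).
  generalize (Rle_abs (x ^ n)); lra.
Qed.

(** Far enough along the sequence a q^N is so small that the product started
    there stays above 1/2.  To cover the first indices as well, the product up
    to N + n is factored in two ways: (a)_N times a factor that is at least 1/2,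
    and (a)_n times a factor that is at most M. *)
Lemma qpoch_lower_bound (a q : C) :
  (Cmod q < 1)%R -> admissible q a ->
  exists c, (0 < c)%R /\ forall n, (c <= Cmod (qpoch a q n))%R.
Proof.
  intros Hq Ha.
  pose proof (Cmod_ge_0 q) as Hq0; pose proof (Cmod_ge_0 a) as Ha0.
  destruct (pow_eventually_small (Cmod q) ((1 - Cmod q) / (2 * (Cmod a + 1))))
    as [N HN]; [lra|apply Rdiv_lt_0_compat; lra|].
  assert (HaN : (Cmod (a * q ^ N) <= (1 - Cmod q) / 2)%R).
  { rewrite Cmod_mult, Cmod_pow.
    apply Rle_trans with ((Cmod a + 1) * ((1 - Cmod q) / (2 * (Cmod a + 1))))%R.
    - apply Rmult_le_compat; [lra|now apply pow_le|lra|now apply HN].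
    - apply Req_le; field; lra. }
  destruct (qpoch_bounded q (Cmod a) Hq) as [M [HM Hb]].
  assert (HPN : (0 < Cmod (qpoch a q N))%R) by (apply Cmod_gt_0, Ha).
  exists (Cmod (qpoch a q N) / (2 * M))%R; split.
  { apply Rdiv_lt_0_compat; lra. }
  intros n.
  (* the Weierstrass lower bound at a q^N is 1 minus at most 1/2 *)
  assert (H1 : (/ 2 <= Cmod (qpoch (a * q ^ N) q n))%R).
  { eapply Rle_trans; [|apply qpoch_ge; lra].
    set (u := Cmod (a * q ^ N)) in *.
    assert (0 <= Cmod q ^ n)%R by now apply pow_le.
    assert (0 <= u)%R by apply Cmod_ge_0.
    assert (u * (1 - Cmod q ^ n) / (1 - Cmod q) * (1 - Cmod q) = u * (1 - Cmod q ^ n))%R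
      by (field; lra).
    nra. }
  assert (H2 : (Cmod (qpoch a q n) * M >= Cmod (qpoch a q N) / 2)%R).
  { apply Rle_ge, Rle_trans with (Cmod (qpoch a q (N + n))).
    - rewrite qpoch_add, Cmod_mult; unfold Rdiv.
      apply Rmult_le_compat_l; lra.
    - rewrite Nat.add_comm, qpoch_add, Cmod_mult.
      apply Rmult_le_compat_l; [apply Cmod_ge_0|].
      apply Hb; rewrite Cmod_mult.
      generalize (Cmod_pow_le_1 q n Hq); nra. }
  apply Rmult_le_reg_r with M; [lra|].
  replace (Cmod (qpoch a q N) / (2 * M) * M)%R with (Cmod (qpoch a q N) / 2)%R
    by (field; lra).
  lra.
Qed.

Lemma qpoch_inf_neq_0 (a q : C) :
  (Cmod q < 1)%R -> admissible q a -> qpoch_inf a q <> 0.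
Proof.
  intros Hq Ha.
  destruct (qpoch_lower_bound a q Hq Ha) as [c [Hc Hb]].
  apply (Clim_lower_bound _ _ c (qpoch_inf_lim a q Hq) Hc Hb).
Qed.

Lemma admissible_lt_1 (a q : C) :
  (Cmod q < 1)%R -> (Cmod a < 1)%R -> admissible q a.
Proof.
  intros Hq Ha n; induction n as [|n IH]; simpl.
  - intros E; injection E; lra.
  - apply Cmult_neq_0; [exact IH|].
    apply Cmod_gt_0.
    eapply Rlt_le_trans; [|apply Cmod_one_minus_ge].
    rewrite Cmod_mult.
    generalize (Cmod_pow_le_1 q n Hq) (Cmod_ge_0 a) (Cmod_ge_0 (q ^ n)); nra.
Qed.

Lemma qpoch_inf_split (a q : C) (k : nat) :
  (Cmod q < 1)%R -> qpoch_inf a q = qpoch a q k * qpoch_inf (a * q ^ k) q.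
Proof.
  intros Hq.
  apply (Clim_unique (fun n => qpoch a q (n + k))).
  - apply (is_lim_seq_incr_n (fun n => Cmod (qpoch a q n - qpoch_inf a q))).
    now apply qpoch_inf_lim.
  - eapply is_lim_seq_ext;
      [|apply (Clim_mult _ _ _ _ (Clim_const (qpoch a q k))
                 (qpoch_inf_lim (a * q ^ k) q Hq))].
    intros n; simpl; rewrite Nat.add_comm, qpoch_add; reflexivity.
Qed.

Lemma qpoch_zero_after (a q : C) (k n : nat) :
  qpoch a q k = 0 -> (k <= n)%nat -> qpoch a q n = 0.
Proof.
  intros E Hn; replace n with (k + (n - k))%nat by lia.
  rewrite qpoch_add, E; ring.
Qed.

(** * The q-binomial theorem *)

Definition qbin_coef (a q : C) (m : nat) : C := qpoch a q m / qpoch q q m.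

Lemma qpoch_q_neq_0 (q : C) (n : nat) : (Cmod q < 1)%R -> qpoch q q n <> 0.
Proof. intros Hq; now apply admissible_lt_1. Qed.

Lemma qbin_coef_S (a q : C) (m : nat) :
  (Cmod q < 1)%R ->
  qbin_coef a q (S m) * (1 - q ^ S m) = qbin_coef a q m * (1 - a * q ^ m).
Proof.
  intros Hq; unfold qbin_coef.
  pose proof (qpoch_q_neq_0 q m Hq) as H1.
  pose proof (qpoch_q_neq_0 q (S m) Hq) as H2.
  simpl in H2 |- *; field; split; [exact H1|].
  intros E; apply H2; rewrite E; ring.
Qed.

Lemma qbin_coef_0 (a q : C) : qbin_coef a q 0 = 1.
Proof. unfold qbin_coef; simpl; field. Qed.

(** This functional equation determines the q-binomial series: it comes from the
    two-term recurrence [qbin_coef_S] of its coefficients. *)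
Lemma q_difference_eq (a q w F G : C) :
  (Cmod q < 1)%R ->
  is_series (fun m => qbin_coef a q m * w ^ m) F ->
  is_series (fun m => qbin_coef a q m * (q * w) ^ m) G ->
  (1 - w) * F = (1 - a * w) * G.
Proof.
  intros Hq HF HG.
  enough (E : F - G = w * (F - a * G)).
  { replace ((1 - w) * F) with (F - G + G - w * F) by ring; rewrite E; ring. }
  apply (is_series_C_unique
           (fun m => qbin_coef a q (S m) * w ^ S m
                     - qbin_coef a q (S m) * (q * w) ^ S m)).
  - generalize (is_series_C_minus _ _ _ _ HF HG); intros H.
    apply (is_series_incr_1 (V := C_NormedModule)
             (fun m => qbin_coef a q m * w ^ m - qbin_coef a q m * (q * w) ^ m)).
    match goal with |- is_series _ ?l => replace l with (F - G); [exact H|] end.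
    simpl; change plus with Cplus; ring.
  - eapply is_series_C_ext;
      [|apply (is_series_C_scal w), is_series_C_minus;
        [exact HF|apply (is_series_C_scal a), HG]].
    intros m; simpl.
    generalize (qbin_coef_S a q m Hq); simpl; rewrite !Cpow_mult_l; intros E.
    transitivity ((qbin_coef a q (S m) * (1 - q * q ^ m)) * (w * w ^ m)); [|ring].
    rewrite E; ring.
Qed.

(** Iterating the functional equation n times turns F(z) into F(q^n z), and
    F(q^n z) tends to F(0) = 1.  Assuming absolute convergence at z, instead of
    |z| < 1, also covers the terminating series, for which |z| may be large;
    for that reason (z)_oo stays on the left-hand side. *)
Lemma q_binomial (a q z : C) :
  (Cmod q < 1)%R ->
  ex_series (fun m => Cmod (qbin_coef a q m * z ^ m)) ->
  exists F : C, is_series (fun m => qbin_coef a q m * z ^ m) F /\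
            qpoch_inf z q * F = qpoch_inf (a * z) q.
Proof.
  intros Hq Habs.
  pose proof (Cmod_ge_0 q) as Hq0.
  (* for fixed n, the terms of the series at q^n z *)
  set (u := fun n m => qbin_coef a q m * (q ^ n * z) ^ m).
  assert (Hu : forall n, is_series (u n) (CSeries (u n))).
  { intros n.
    destruct (ex_series_Cmod_le (u n) (fun m => Cmod (qbin_coef a q m * z ^ m)))
      as [l Hl]; [|exact Habs|now rewrite (CSeries_unique _ _ Hl)].
    intros m; unfold u; rewrite Cpow_mult_l, !Cmod_mult.
    apply Rmult_le_compat_l; [apply Cmod_ge_0|].
    rewrite <- Cpow_mult_r.
    generalize (Cmod_pow_le_1 q (n * m) Hq) (Cmod_ge_0 (z ^ m)); nra. }
  set (F := fun n => CSeries (u n)).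
  exists (F O); split.
  { eapply is_series_C_ext; [|apply (Hu O)].
    intros m; unfold u; simpl; now rewrite Cmult_1_l. }
  assert (Hrec : forall n, qpoch z q n * F O = qpoch (a * z) q n * F n).
  { induction n as [|n IH]; [reflexivity|].
    assert (E : (1 - q ^ n * z) * F n = (1 - a * (q ^ n * z)) * F (S n)).
    { apply (q_difference_eq a q); [exact Hq|apply Hu|].
      eapply is_series_C_ext; [|apply (Hu (S n))].
      intros m; unfold u; simpl; now rewrite Cmult_assoc. }
    simpl.
    transitivity ((1 - q ^ n * z) * (qpoch z q n * F O)); [ring|].
    rewrite IH.
    transitivity (qpoch (a * z) q n * ((1 - q ^ n * z) * F n)); [ring|].
    rewrite E; ring. }
  assert (HF1 : Clim F 1).
  { destruct Habs as [L HL].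
    (* the terms with m >= 1 gain a factor at least as small as |q|^n *)
    apply Clim_squeeze with (fun n => (Cmod q ^ n * (L - 1))%R).
    2:{ replace 0%R with (0 * (L - 1))%R by ring.
        apply is_lim_seq_mult'; [|apply is_lim_seq_const].
        apply is_lim_seq_geom; rewrite Rabs_pos_eq; lra. }
    intros n.
    refine (is_series_Cmod_le (fun m => u n (S m)) _
              (fun m => (Cmod q ^ n * Cmod (qbin_coef a q (S m) * z ^ S m))%R) _ _ _ _).
    - intros m; unfold u.
      rewrite Cpow_mult_l, !Cmod_mult, <- Cpow_mult_r, !Cmod_pow.
      rewrite (Rmult_comm (Cmod q ^ n)), Rmult_assoc.
      apply Rmult_le_compat_l; [apply Cmod_ge_0|].
      rewrite Rmult_comm; apply Rmult_le_compat_l; [apply pow_le, Cmod_ge_0|].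
      rewrite Nat.mul_succ_r, pow_add, Rmult_comm.
      rewrite <- (Rmult_1_r (Cmod q ^ n)) at 2.
      apply Rmult_le_compat_l; [now apply pow_le|].
      rewrite <- (pow1 (n * m)); apply pow_incr; lra.
    - apply (is_series_incr_1 (V := C_NormedModule) (u n)).
      match goal with |- is_series _ ?l => replace l with (F n); [apply Hu|] end.
      unfold u; simpl; rewrite qbin_coef_0; change plus with Cplus; ring.
    - apply (is_series_scal (V := R_NormedModule) (Cmod q ^ n)%R).
      apply (is_series_incr_1 (V := R_NormedModule)
               (fun m => Cmod (qbin_coef a q m * z ^ m))).
      match goal with |- is_series _ ?l => replace l with L; [exact HL|] end.
      simpl; rewrite qbin_coef_0, Cmult_1_l, Cmod_1.
      symmetry; change (L - 1 + 1 = L)%R; rewrite Rplus_comm; apply Rplus_minus. }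
  apply (Clim_unique (fun n => qpoch z q n * F O)).
  - apply Clim_mult; [now apply qpoch_inf_lim|apply Clim_const].
  - replace (qpoch_inf (a * z) q) with (qpoch_inf (a * z) q * 1) by ring.
    eapply is_lim_seq_ext;
      [|apply (Clim_mult _ _ _ _ (qpoch_inf_lim (a * z) q Hq) HF1)].
    intros n; simpl; now rewrite Hrec.
Qed.

Lemma qbin_coef_bounded (q : C) (A : R) :
  (Cmod q < 1)%R ->
  exists M, (0 < M)%R /\
    forall a m, (Cmod a <= A)%R -> (Cmod (qbin_coef a q m) <= M)%R.
Proof.
  intros Hq.
  destruct (qpoch_bounded q A Hq) as [M [HM HMb]].
  destruct (qpoch_lower_bound q q Hq (admissible_lt_1 q q Hq Hq)) as [c [Hc Hcb]].
  exists (M / c)%R; split; [now apply Rdiv_lt_0_compat|].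
  intros a m Ha; unfold qbin_coef.
  rewrite Cmod_div by now apply qpoch_q_neq_0.
  unfold Rdiv; apply Rmult_le_compat; [apply Cmod_ge_0| |now apply HMb|].
  - left; apply Rinv_0_lt_compat; specialize (Hcb m); lra.
  - apply Rinv_le_contravar; [exact Hc|apply Hcb].
Qed.

Lemma q_binomial_abs (a q z : C) :
  (Cmod q < 1)%R -> (Cmod z < 1)%R ->
  ex_series (fun m => Cmod (qbin_coef a q m * z ^ m)).
Proof.
  intros Hq Hz.
  destruct (qbin_coef_bounded q (Cmod a) Hq) as [M [HM Hb]].
  apply ex_series_R_le with (fun m => (M * Cmod z ^ m)%R).
  - intros m; split; [apply Cmod_ge_0|].
    rewrite Cmod_mult, Cmod_pow.
    apply Rmult_le_compat_r; [apply pow_le, Cmod_ge_0|apply Hb; lra].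
  - apply ex_series_geom_scal; split; [apply Cmod_ge_0|exact Hz].
Qed.

(** The factor E may vanish, and then nothing is known about the series itself,
    so that one cannot just divide by E. *)
Lemma q_binomial_scaled (E a q z : C) :
  (Cmod q < 1)%R -> qpoch_inf z q <> 0 ->
  ex_series (fun m => Cmod (E * (qbin_coef a q m * z ^ m))) ->
  is_series (fun m => E * (qbin_coef a q m * z ^ m))
            (E * (qpoch_inf (a * z) q / qpoch_inf z q)).
Proof.
  intros Hq Hz Habs.
  assert (H : exists F : C, is_series (fun m => E * (qbin_coef a q m * z ^ m)) (E * F)
              /\ E * F = E * (qpoch_inf (a * z) q / qpoch_inf z q)).
  { destruct (classic (E = 0)) as [->|HE].
    - exists 0; split; [|ring].
      apply is_series_Clim.
      apply Clim_squeeze with (fun _ => 0%R); [|apply is_lim_seq_const].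
      intros n; replace (sum_n (fun m => 0 * (qbin_coef a q m * z ^ m)) n) with (RtoC 0).
      + replace (0 - 0 * 0) with (RtoC 0) by ring; rewrite Cmod_0; lra.
      + rewrite (sum_n_ext _ (fun _ => RtoC 0)) by (intros; apply Cmult_0_l).
        symmetry; apply (sum_n_m_const_zero (G := C_AbelianMonoid)).
    - destruct (q_binomial a q z Hq) as [F [HF HE']].
      + refine (ex_series_ext _ _ _
                  (ex_series_scal_l (V := R_NormedModule) (/ Cmod E)%R _ Habs)).
        intros m.
        change (/ Cmod E * Cmod (E * (qbin_coef a q m * z ^ m))
                = Cmod (qbin_coef a q m * z ^ m))%R.
        apply Cmod_gt_0 in HE; rewrite (Cmod_mult E); field; lra.
      + exists F; split; [now apply is_series_C_scal|].
        f_equal; rewrite <- HE'; field; exact Hz. }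
  destruct H as [F [HF <-]]; exact HF.
Qed.

(** * Convergence of hypergeometric series *)

Lemma qpochs_snoc (l : list C) (c q : C) (n : nat) :
  qpochs (l ++ [c]) q n = qpochs l q n * qpoch c q n.
Proof.
  unfold qpochs; induction l as [|c' l IH]; simpl; [ring|].
  rewrite IH; ring.
Qed.

Lemma qpochs_bounded (l : list C) (q : C) :
  (Cmod q < 1)%R ->
  exists M, (0 < M)%R /\ forall n, (Cmod (qpochs l q n) <= M)%R.
Proof.
  intros Hq; unfold qpochs; induction l as [|c l [M [HM IH]]]; simpl.
  - exists 1%R; split; [lra|]; intros _; rewrite Cmod_1; lra.
  - destruct (qpoch_bounded q (Cmod c) Hq) as [M' [HM' H']].
    exists (M' * M)%R; split; [now apply Rmult_lt_0_compat|].
    intros n; rewrite Cmod_mult.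
    apply Rmult_le_compat; auto using Cmod_ge_0; apply H'; lra.
Qed.

Lemma qpochs_lower_bound (l : list C) (q : C) :
  (Cmod q < 1)%R -> (forall c, In c l -> admissible q c) ->
  exists m, (0 < m)%R /\ forall n, (m <= Cmod (qpochs l q n))%R.
Proof.
  intros Hq; unfold qpochs; induction l as [|c l IH]; simpl; intros Hl.
  - exists 1%R; split; [lra|]; intros _; rewrite Cmod_1; lra.
  - destruct IH as [m [Hm IH]]; [intros; apply Hl; now right|].
    destruct (qpoch_lower_bound c q Hq) as [m' [Hm' H']]; [apply Hl; now left|].
    exists (m' * m)%R; split; [now apply Rmult_lt_0_compat|].
    intros n; rewrite Cmod_mult; apply Rmult_le_compat; auto; lra.
Qed.

Lemma qpochs_zero_after (l : list C) (c q : C) (k n : nat) :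
  In c l -> qpoch c q k = 0 -> (k <= n)%nat -> qpochs l q n = 0.
Proof.
  unfold qpochs; induction l as [|c' l IH]; simpl; [easy|].
  intros [->|Hc] E Hn.
  - rewrite (qpoch_zero_after _ _ _ _ E Hn); ring.
  - rewrite IH by assumption; ring.
Qed.

Lemma qpochs_neq_0 (l : list C) (q : C) (n : nat) :
  (forall c, In c l -> admissible q c) -> qpochs l q n <> 0.
Proof.
  unfold qpochs; induction l as [|c l IH]; simpl; intros H.
  - intros E; injection E; lra.
  - apply Cmult_neq_0; [apply H; now left|apply IH; intros; apply H; now right].
Qed.

(** The factor (q)_k is one more denominator parameter, and an admissible one. *)
Lemma hyp_term_eq (alphas betas : list C) (q z : C) (k : nat) :
  (Cmod q < 1)%R -> (forall beta, In beta betas -> admissible q beta) ->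
  hyp_term alphas betas q z k
  = qpochs alphas q k / qpochs (q :: betas) q k * z ^ k.
Proof.
  intros Hq Hbetas; unfold hyp_term.
  change (qpochs (q :: betas) q k) with (qpoch q q k * qpochs betas q k).
  field; auto using qpoch_q_neq_0, qpochs_neq_0.
Qed.

(** A hypergeometric series has no conditional convergence.  Either a numerator
    parameter makes it terminate, or the coefficients are bounded and bounded
    away from 0; then the terms are comparable to |z|^k, and convergence forces
    |z| < 1. *)
Lemma hyp_term_abs (alphas betas : list C) (q z : C) :
  (Cmod q < 1)%R -> (forall beta, In beta betas -> admissible q beta) ->
  ex_series (hyp_term alphas betas q z) ->
  ex_series (fun k => Cmod (hyp_term alphas betas q z k)).
Proof.
  intros Hq Hbetas Hex.
  assert (Hden : forall beta, In beta (q :: betas) -> admissible q beta).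
  { intros beta [<-|Hbeta]; [now apply admissible_lt_1|now apply Hbetas]. }
  assert (Hterm : forall k, Cmod (hyp_term alphas betas q z k)
    = (Cmod (qpochs alphas q k) * / Cmod (qpochs (q :: betas) q k)
       * Cmod z ^ k)%R).
  { intros k; rewrite hyp_term_eq by assumption.
    rewrite Cmod_mult, Cmod_div, Cmod_pow by now apply qpochs_neq_0.
    reflexivity. }
  destruct (classic (forall c, In c alphas -> admissible q c)) as [Hadm|Hnadm].
  2:{ (* one vanishing (c)_k makes all later terms vanish *)
      apply not_all_ex_not in Hnadm as [c Hc].
      apply imply_to_and in Hc as [Hc Hk].
      apply not_all_ex_not in Hk as [k Hk]; apply NNPP in Hk.
      apply (ex_series_incr_n (V := R_NormedModule) _ k).
      apply ex_series_ext with (fun n => (0 * 0 ^ n)%R).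
      - intros n; rewrite Hterm, (qpochs_zero_after _ _ _ _ _ Hc Hk) by lia.
        rewrite Cmod_0, !Rmult_0_l; reflexivity.
      - apply ex_series_geom_scal; lra. }
  destruct (qpochs_bounded alphas q Hq) as [M [HM HMb]].
  destruct (qpochs_bounded (q :: betas) q Hq) as [M1 [HM1 HMb1]].
  destruct (qpochs_lower_bound alphas q Hq Hadm) as [m [Hm Hmb]].
  destruct (qpochs_lower_bound (q :: betas) q Hq Hden) as [m1 [Hm1 Hmb1]].
  destruct (Rlt_le_dec (Cmod z) 1) as [Hz|Hz].
  - apply ex_series_R_le with (fun k => (M * / m1 * Cmod z ^ k)%R).
    + intros k; split; [apply Cmod_ge_0|rewrite Hterm].
      specialize (Hmb1 k).
      apply Rmult_le_compat_r; [apply pow_le, Cmod_ge_0|].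
      apply Rmult_le_compat; [apply Cmod_ge_0| |apply HMb|].
      * left; apply Rinv_0_lt_compat; lra.
      * now apply Rinv_le_contravar.
    + apply ex_series_geom_scal; split; [apply Cmod_ge_0|exact Hz].
  - (* here |z|^k >= 1, so that the terms do not tend to 0 *)
    exfalso.
    apply (Clim_lower_bound _ _ (m * / M1)%R (series_terms_lim_0 _ Hex));
      [|intros k|reflexivity].
    + apply Rmult_lt_0_compat; auto using Rinv_0_lt_compat.
    + rewrite Hterm, <- (Rmult_1_r (m * / M1)).
      specialize (Hmb1 k).
      assert (0 < / M1)%R by now apply Rinv_0_lt_compat.
      apply Rmult_le_compat; [apply Rmult_le_pos; lra|lra| |now apply pow_R1_Rle].
      apply Rmult_le_compat; [lra|lra|apply Hmb|].
      apply Rinv_le_contravar; [lra|apply HMb1].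
Qed.

(** * Rows of the double series *)

(** The part of the summands of row k that does not depend on n; it is also
    the entry of the row at n = k. *)
Definition row_factor (q lambda A X : C) (k : nat) : C :=
  qpoch lambda q k / qpoch q q k * A * X ^ k.

(** With n = k + m, the factorisation (lambda)_n = (lambda)_k (lambda q^k)_m and
    the cancellation of (q)_n make row k a q-binomial series in m. *)
Lemma row_term (q lambda A x y t : C) (k m : nat) :
  (Cmod q < 1)%R ->
  qpoch lambda q (k + m)
    * (qbinom q (k + m) k * A * (x ^ k * y ^ (k + m - k)))
    * (t ^ (k + m) / qpoch q q (k + m))
  = row_factor q lambda A (x * t) k
    * (qbin_coef (lambda * q ^ k) q m * (y * t) ^ m).
Proof.
  intros Hq; unfold row_factor, qbin_coef, qbinom.
  rewrite qpoch_add.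
  replace (k + m - k)%nat with m by lia.
  rewrite !Cpow_mult_l, !Cpow_add_r.
  field; repeat split; now apply qpoch_q_neq_0.
Qed.

(** The coefficient A and the variable y are arbitrary so that psi is covered
    too: of its factor q^(-nk), the part q^(-k^2) belongs to A, and the part
    q^(-k(n-k)) turns y into y / q^k. *)
Lemma row_sum (q lambda A x y t : C) (k : nat) (d : nat -> C) :
  (Cmod q < 1)%R ->
  (forall n, (n < k)%nat -> d n = 0) ->
  (forall n, (k <= n)%nat ->
     d n = qpoch lambda q n * (qbinom q n k * A * (x ^ k * y ^ (n - k)))
           * (t ^ n / qpoch q q n)) ->
  qpoch_inf (y * t) q <> 0 ->
  ex_series (fun n => Cmod (d n)) ->
  is_series d (row_factor q lambda A (x * t) k
               * (qpoch_inf (lambda * q ^ k * (y * t)) q / qpoch_inf (y * t) q)).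
Proof.
  intros Hq Hlt Hge Hz Habs.
  assert (Hd : forall m, d (k + m)%nat
    = row_factor q lambda A (x * t) k
      * (qbin_coef (lambda * q ^ k) q m * (y * t) ^ m)).
  { intros m; rewrite Hge by lia; now apply row_term. }
  apply is_series_delay with k; [exact Hlt|].
  eapply is_series_C_ext; [intros m; symmetry; apply Hd|].
  apply q_binomial_scaled; [exact Hq|exact Hz|].
  eapply ex_series_ext; [intros m; apply (f_equal Cmod), Hd|].
  now apply (ex_series_incr_n (V := R_NormedModule) (fun n => Cmod (d n))).
Qed.

Definition srivastava_weight (lambda q t : C) (n : nat) : C :=
  qpoch lambda q n * (t ^ n / qpoch q q n).

Definition phi_term (a b : list C) (n : nat) (x y q : C) (k : nat) : C :=
  qbinom q n k * (qpochs a q k / qpochs b q k) * (x ^ k * y ^ (n - k)).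

(** What remains of the k-th coefficient of psi once q^(-k(n-k)) has been
    absorbed in the power of y. *)
Definition psi_coef (a b : list C) (q : C) (k : nat) : C :=
  qpochs a q k / qpochs b q k
  * ((- (1)) ^ k * (q ^ (k * (k + 1) / 2) / q ^ (k * k))).

Lemma Cpow_div (u v : C) (n : nat) : v <> 0 -> (u / v) ^ n = u ^ n / v ^ n.
Proof. intros Hv; unfold Cdiv; now rewrite Cpow_mult_l, Cpow_inv. Qed.

Lemma psi_term_eq (a b : list C) (n : nat) (x y q : C) (k : nat) :
  q <> 0 -> (k <= n)%nat ->
  psi_term a b n x y q k
  = qbinom q n k * psi_coef a b q k * (x ^ k * (y / q ^ k) ^ (n - k)).
Proof.
  intros Hq Hk; unfold psi_term, psi_coef.
  replace (n * k)%nat with (k * k + k * (n - k))%nat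
    by (replace n with (k + (n - k))%nat at 2 by lia; ring).
  rewrite Cpow_add_r, (Cpow_mult_r q k (n - k)).
  rewrite Cpow_div by now apply Cpow_nz.
  set (A := qpochs a q k / qpochs b q k).
  field; auto using Cpow_nz.
Qed.

Lemma triangular_succ (k : nat) :
  (S k * (S k + 1) / 2 = k * (k + 1) / 2 + S k)%nat.
Proof.
  replace (S k * (S k + 1))%nat with (k * (k + 1) + S k * 2)%nat by ring.
  apply Nat.div_add; lia.
Qed.

Lemma triangular_double (k : nat) :
  (k * (k + 1) / 2 + k * (k + 1) / 2 = k * k + k)%nat.
Proof.
  induction k as [|k IH]; [reflexivity|rewrite triangular_succ; lia].
Qed.

(** Each factor 1 - z / q^j is turned over into - (z / q^j) (1 - q^j / z): this is
    how the denominator parameter q / (y t) arises. *)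
Lemma qpoch_reverse (q z : C) (k : nat) :
  q <> 0 -> z <> 0 ->
  qpoch (z / q ^ k) q k
  = (- z) ^ k / q ^ (k * (k + 1) / 2) * qpoch (q / z) q k.
Proof.
  intros Hq Hz; induction k as [|k IH].
  - simpl; field.
  - rewrite qpoch_S_front, triangular_succ, Cpow_add_r.
    pose proof (Cpow_nz q k Hq) as Hqk.
    pose proof (Cpow_nz q (k * (k + 1) / 2) Hq) as Hqt.
    replace (z / q ^ S k * q) with (z / q ^ k)
      by (rewrite Cpow_S; field; auto).
    rewrite IH; simpl qpoch; rewrite !Cpow_S.
    field; auto.
Qed.

Lemma pos_seq_lower_bound (v : nat -> R) (N : nat) :
  (forall n, (0 < v n)%R) ->
  (forall n, (N <= n)%nat -> (v n <= v (S n))%R) ->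
  exists c, (0 < c)%R /\ forall n, (c <= v n)%R.
Proof.
  intros Hpos Hmon.
  assert (H : exists c, (0 < c)%R /\ forall n, (n <= N)%nat -> (c <= v n)%R).
  { clear Hmon; induction N as [|N [c [Hc IH]]].
    - exists (v O); split; [apply Hpos|].
      intros n Hn; replace n with O by lia; lra.
    - exists (Rmin c (v (S N))); split; [now apply Rmin_pos|].
      intros n Hn; destruct (Nat.eq_dec n (S N)) as [->|Hne]; [apply Rmin_r|].
      eapply Rle_trans; [apply Rmin_l|apply IH; lia]. }
  destruct H as [c [Hc H]]; exists c; split; [exact Hc|].
  intros n; destruct (Nat.le_gt_cases n N) as [Hn|Hn]; [now apply H|].
  induction n as [|n IH]; [lia|].
  eapply Rle_trans; [|apply Hmon; lia].
  destruct (Nat.eq_dec n N) as [->|Hne]; [apply H; lia|apply IH; lia].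
Qed.

(** The product for k + 1 has one new factor, 1 - z / q^(k+1).  These factors do
    not vanish, and their modulus is at least 1 once |q|^(k+1) <= |z| / 2. *)
Lemma qpoch_shifted_down_lower_bound (q z : C) :
  (Cmod q < 1)%R -> q <> 0 -> z <> 0 -> admissible q (q / z) ->
  exists c, (0 < c)%R /\ forall k, (c <= Cmod (qpoch (z / q ^ k) q k))%R.
Proof.
  intros Hq1 Hq Hz Hadm.
  pose proof (proj1 (Cmod_gt_0 z) Hz) as Hz'.
  pose proof (proj1 (Cmod_gt_0 q) Hq) as Hq'.
  assert (Hpos : forall k, (0 < Cmod (qpoch (z / q ^ k) q k))%R).
  { intros k; apply Cmod_gt_0; rewrite qpoch_reverse by assumption.
    apply Cmult_neq_0; [|apply Hadm].
    apply Cmod_gt_0.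
    rewrite Cmod_div, !Cmod_pow, Cmod_opp by now apply Cpow_nz.
    apply Rdiv_lt_0_compat; now apply pow_lt. }
  destruct (pow_eventually_small (Cmod q) (Cmod z / 2)) as [N HN]; [lra|lra|].
  apply (pos_seq_lower_bound _ N Hpos).
  intros k Hk.
  rewrite qpoch_S_front, Cmod_mult.
  replace (z / q ^ S k * q) with (z / q ^ k)
    by (rewrite Cpow_S; field; split; [now apply Cpow_nz|exact Hq]).
  assert (H2 : (2 <= Cmod (z / q ^ S k))%R).
  { rewrite Cmod_div, Cmod_pow by now apply Cpow_nz.
    assert (0 < Cmod q ^ S k)%R by now apply pow_lt.
    apply Rmult_le_reg_r with (Cmod q ^ S k)%R; [assumption|].
    unfold Rdiv; rewrite Rmult_assoc, Rinv_l by lra.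
    specialize (HN (S k) ltac:(lia)); lra. }
  assert (H1 : (1 <= Cmod (1 - z / q ^ S k))%R).
  { generalize (Cmod_one_minus_le (1 - z / q ^ S k)).
    replace (1 - (1 - z / q ^ S k)) with (z / q ^ S k) by ring; lra. }
  rewrite <- (Rmult_1_l (Cmod (qpoch (z / q ^ k) q k))) at 1.
  apply Rmult_le_compat_r; [apply Cmod_ge_0|exact H1].
Qed.

Lemma phi_row_value (a b : list C) (q lambda x y t : C) (k : nat) :
  (Cmod q < 1)%R -> (forall beta, In beta b -> admissible q beta) ->
  admissible q (lambda * y * t) -> qpoch_inf (y * t) q <> 0 ->
  row_factor q lambda (qpochs a q k / qpochs b q k) (x * t) k
    * (qpoch_inf (lambda * q ^ k * (y * t)) q / qpoch_inf (y * t) q)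
  = qpoch_inf (lambda * y * t) q / qpoch_inf (y * t) q
    * hyp_term (a ++ [lambda]) (b ++ [lambda * y * t]) q (x * t) k.
Proof.
  intros Hq Hb Hadm Hinf.
  unfold row_factor, hyp_term.
  rewrite !qpochs_snoc, (qpoch_inf_split (lambda * y * t) q k Hq).
  replace (lambda * q ^ k * (y * t)) with (lambda * y * t * q ^ k) by ring.
  field; repeat split; auto using qpoch_q_neq_0, qpochs_neq_0.
Qed.

Lemma psi_row_factor (a b : list C) (q lambda x y t : C) (k : nat) :
  (Cmod q < 1)%R -> (forall beta, In beta b -> admissible q beta) ->
  q <> 0 -> y <> 0 -> t <> 0 -> qpoch (q / (y * t)) q k <> 0 ->
  row_factor q lambda (psi_coef a b q k) (x * t) k
  = qpoch (y * t / q ^ k) q k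
    * hyp_term (a ++ [lambda]) (b ++ [q / (y * t)]) q (x * q / y) k.
Proof.
  intros Hq Hb Hq0 Hy Ht Hpoch.
  rewrite qpoch_reverse by auto using Cmult_neq_0.
  unfold row_factor, hyp_term, psi_coef.
  rewrite !qpochs_snoc.
  pose proof (Cpow_nz q (k * (k + 1) / 2) Hq0) as Hqt.
  pose proof (Cpow_nz q (k * k) Hq0) as Hqk.
  assert (E : q ^ (k * k) * q ^ k
              = q ^ (k * (k + 1) / 2) * q ^ (k * (k + 1) / 2))
    by (rewrite <- !Cpow_add_r, triangular_double; reflexivity).
  rewrite Cpow_div by assumption.
  replace (- (y * t)) with (- (1) * (y * t)) by ring.
  rewrite !Cpow_mult_l.
  pose proof (Cpow_nz y k Hy) as Hyk.
  pose proof (qpoch_q_neq_0 q k Hq) as Hqq.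
  pose proof (qpochs_neq_0 b q k Hb) as Hbk.
  transitivity ((- (1)) ^ k * x ^ k * t ^ k * qpochs a q k * qpoch lambda q k
    / (qpochs b q k * qpoch q q k * q ^ (k * (k + 1) / 2))
    * ((q ^ (k * (k + 1) / 2) * q ^ (k * (k + 1) / 2)) / q ^ (k * k))).
  - field; auto.
  - rewrite <- E; field; repeat split; auto.
Qed.

Lemma psi_row_value (a b : list C) (q lambda x y t : C) (k : nat) :
  (Cmod q < 1)%R -> (forall beta, In beta b -> admissible q beta) ->
  q <> 0 -> y <> 0 -> t <> 0 -> qpoch_inf (y / q ^ k * t) q <> 0 ->
  row_factor q lambda (psi_coef a b q k) (x * t) k
    * (qpoch_inf (lambda * q ^ k * (y / q ^ k * t)) q
       / qpoch_inf (y / q ^ k * t) q)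
  = qpoch_inf (lambda * y * t) q / qpoch_inf (y * t) q
    * hyp_term (a ++ [lambda]) (b ++ [q / (y * t)]) q (x * q / y) k.
Proof.
  intros Hq Hb Hq0 Hy Ht Hinf.
  pose proof (Cpow_nz q k Hq0) as Hqk.
  replace (lambda * q ^ k * (y / q ^ k * t)) with (lambda * y * t)
    by (field; exact Hqk).
  revert Hinf.
  replace (y / q ^ k * t) with (y * t / q ^ k) by (field; exact Hqk).
  rewrite (qpoch_inf_split (y * t / q ^ k) q k Hq).
  replace (y * t / q ^ k * q ^ k) with (y * t) by (field; exact Hqk).
  intros Hinf.
  assert (H1 : qpoch (y * t / q ^ k) q k <> 0)
    by (intros E; apply Hinf; rewrite E; ring).
  assert (H2 : qpoch_inf (y * t) q <> 0)
    by (intros E; apply Hinf; rewrite E; ring).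
  rewrite (psi_row_factor a b q lambda x y t); try assumption; [field; auto|].
  intros E; apply H1; rewrite qpoch_reverse, E by auto using Cmult_neq_0; ring.
Qed.

Lemma psi_row (a b : list C) (q lambda x y t : C) (k : nat) :
  (Cmod q < 1)%R -> (forall beta, In beta b -> admissible q beta) ->
  q <> 0 -> y <> 0 -> t <> 0 -> qpoch_inf (y / q ^ k * t) q <> 0 ->
  ex_series (fun n => Cmod (triangle (srivastava_weight lambda q t)
                       (fun n => psi_term a b n x y q) k n)) ->
  is_series (triangle (srivastava_weight lambda q t)
               (fun n => psi_term a b n x y q) k)
    (qpoch_inf (lambda * y * t) q / qpoch_inf (y * t) q
     * hyp_term (a ++ [lambda]) (b ++ [q / (y * t)]) q (x * q / y) k).
Proof.
  intros Hq Hb Hq0 Hy Ht Hinf Habs.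
  rewrite <- psi_row_value by assumption.
  apply (row_sum q lambda _ x _ t); auto using triangle_lt.
  intros n Hn; rewrite triangle_ge, psi_term_eq by assumption.
  unfold srivastava_weight; ring.
Qed.

(** * The generating functions *)

(** Absolute convergence of the double series: the row factors are summable with
    the hypergeometric terms, by [hyp_term_abs], and the entries of
    row k are at most its row factor times M |y t|^m, with M independent of k.
    The columns are then dominated by a Cauchy product. *)
Lemma phi_generating_function (a b : list C) (q lambda x y t : C) :
  (Cmod q < 1)%R -> (forall beta, In beta b -> admissible q beta) ->
  (Cmod (y * t) < 1)%R -> admissible q (lambda * y * t) ->
  ex_series (hyp_term (a ++ [lambda]) (b ++ [lambda * y * t]) q (x * t)) ->
  is_series
    (fun n => qpoch lambda q n * phi a b n x y q * (t ^ n / qpoch q q n))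
    (qpoch_inf (lambda * y * t) q / qpoch_inf (y * t) q
     * hyp_Phi (a ++ [lambda]) (b ++ [lambda * y * t]) q (x * t)).
Proof.
  intros Hq Hb Hyt Hadm Hex.
  assert (Hinf : qpoch_inf (y * t) q <> 0)
    by (now apply qpoch_inf_neq_0, admissible_lt_1).
  set (d := triangle (srivastava_weight lambda q t)
              (fun n => phi_term a b n x y q)).
  set (E := fun k => row_factor q lambda (qpochs a q k / qpochs b q k) (x * t) k).
  assert (Hdge : forall k n, (k <= n)%nat -> d k n =
    qpoch lambda q n
    * (qbinom q n k * (qpochs a q k / qpochs b q k) * (x ^ k * y ^ (n - k)))
    * (t ^ n / qpoch q q n)).
  { intros k n Hk; unfold d; rewrite triangle_ge by assumption.
    unfold srivastava_weight, phi_term; ring. }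
  assert (HE : ex_series (fun k => Cmod (E k))).
  { destruct (qpoch_bounded q (Cmod (lambda * y * t)) Hq) as [M [HM HMb]].
    apply ex_series_R_le with
      (fun k => (M * Cmod (hyp_term (a ++ [lambda]) (b ++ [(lambda * y * t)%C]) q (x * t)%C k))%R).
    - intros k; split; [apply Cmod_ge_0|].
      replace (E k) with (qpoch (lambda * y * t) q k
        * hyp_term (a ++ [lambda]) (b ++ [lambda * y * t]) q (x * t) k).
      + rewrite Cmod_mult; apply Rmult_le_compat_r; [apply Cmod_ge_0|].
        apply HMb; lra.
      + unfold E, row_factor, hyp_term; rewrite !qpochs_snoc.
        field; repeat split; auto using qpoch_q_neq_0, qpochs_neq_0.
    - apply (ex_series_scal_l (V := R_NormedModule) M), hyp_term_abs; auto.
      intros beta Hbeta; apply in_app_or in Hbeta as [H|[<-|[]]]; auto. }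
  assert (Habs : ex_series (fun n => sum_n (fun k => Cmod (d k n)) n)).
  { destruct (qbin_coef_bounded q (Cmod lambda) Hq) as [M [HM HMb]].
    destruct HE as [L HL].
    destruct (ex_series_geom_scal M (Cmod (y * t))) as [L' HL'];
      [split; [apply Cmod_ge_0|exact Hyt]|].
    generalize (is_series_mult_pos _ _ _ _ HL HL' (fun k => Cmod_ge_0 (E k))); intros HLL.
    eapply ex_series_R_le; [|eexists; apply HLL].
    - intros n; split.
      + apply sum_n_Cmod_ge_0.
      + rewrite sum_n_Reals; apply sum_Rle; intros k Hk.
        rewrite Hdge by assumption.
        replace n with (k + (n - k))%nat at 1 2 3 4 5 by lia.
        rewrite row_term, Cmod_mult by assumption.
        apply Rmult_le_compat_l; [apply Cmod_ge_0|].
        rewrite Cmod_mult, Cmod_pow.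
        apply Rmult_le_compat_r; [apply pow_le, Cmod_ge_0|].
        apply HMb; rewrite Cmod_mult.
        generalize (Cmod_pow_le_1 q k Hq) (Cmod_ge_0 lambda); nra.
    - intros n; apply Rmult_le_pos; [lra|apply pow_le, Cmod_ge_0]. }
  assert (Hlt : forall k n, (n < k)%nat -> d k n = 0)
    by (intros; now apply triangle_lt).
  assert (Hrow : forall k, is_series (d k)
    (qpoch_inf (lambda * y * t) q / qpoch_inf (y * t) q
     * hyp_term (a ++ [lambda]) (b ++ [lambda * y * t]) q (x * t) k)).
  { intros k; rewrite <- phi_row_value by assumption.
    apply (row_sum q lambda _ x _ t); auto; now apply ex_series_row. }
  destruct (triangle_by_rows d _ Hlt Habs Hrow) as [S [HS HR]].
  destruct Hex as [H HH].
  unfold hyp_Phi; rewrite (CSeries_unique _ _ HH).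
  rewrite (is_series_C_unique _ _ _ (is_series_C_scal _ _ _ HH) HR).
  eapply is_series_C_ext; [|exact HS].
  intros n; unfold d; rewrite sum_triangle.
  unfold srivastava_weight, phi, phi_term; ring.
Qed.

(** The expansion of the k-th term is row k of the double series.  It converges
    for |t| < |q|^k / |y|, a radius that shrinks to 0 as k grows: for a
    given t, the rows with large k need not converge. *)
Lemma psi_formal_generating_function (a b : list C) (q lambda x y : C) :
  (Cmod q < 1)%R -> (forall beta, In beta b -> admissible q beta) ->
  q <> 0 -> y <> 0 ->
  formal_sum_eq
    (fun n => qpoch lambda q n * psi a b n x y q / qpoch q q n)
    (fun k t =>
       qpoch_inf (lambda * y * t) q / qpoch_inf (y * t) q
       * hyp_term (a ++ [lambda]) (b ++ [q / (y * t)]) q (x * q / y) k).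
Proof.
  intros Hq Hb Hq0 Hy.
  exists (triangle (fun n => qpoch lambda q n / qpoch q q n)
            (fun n => psi_term a b n x y q)).
  repeat split.
  - intros k; exists (Cmod q ^ k / Cmod y)%R.
    pose proof (proj1 (Cmod_gt_0 q) Hq0) as Hq0'.
    pose proof (proj1 (Cmod_gt_0 y) Hy) as Hy'.
    pose proof (pow_lt _ k Hq0') as Hqk.
    split; [now apply Rdiv_lt_0_compat|].
    intros t Ht Htr.
    assert (Hlt : (Cmod (y / q ^ k * t) < 1)%R).
    { rewrite Cmod_mult, Cmod_div, Cmod_pow by now apply Cpow_nz.
      apply Rmult_lt_reg_r with (Cmod q ^ k / Cmod y)%R;
        [now apply Rdiv_lt_0_compat|].
      replace (Cmod y / Cmod q ^ k * Cmod t * (Cmod q ^ k / Cmod y))%R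
        with (Cmod t) by (field; lra).
      lra. }
    apply is_series_C_ext with (triangle (srivastava_weight lambda q t)
                                (fun n => psi_term a b n x y q) k).
    { intros n; unfold triangle, srivastava_weight.
      destruct (k <=? n)%nat; unfold Cdiv; ring. }
    apply psi_row; auto.
    { now apply qpoch_inf_neq_0, admissible_lt_1. }
    apply (ex_series_incr_n (V := R_NormedModule) _ k).
    apply ex_series_ext with (fun m =>
      (Cmod (row_factor q lambda (psi_coef a b q k) (x * t)%C k)
       * Cmod (qbin_coef (lambda * q ^ k)%C q m * (y / q ^ k * t) ^ m)%C)%R).
    { intros m; rewrite <- Cmod_mult; rewrite <- row_term by assumption.
      apply (f_equal Cmod).
      rewrite triangle_ge, psi_term_eq by (auto; lia).
      unfold srivastava_weight; ring. }
    apply (ex_series_scal_l (V := R_NormedModule)).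
    now apply q_binomial_abs.
  - intros k n; apply triangle_lt.
  - intros n; rewrite sum_triangle; unfold psi, Cdiv; ring.
Qed.

(** Convergence of the hypergeometric series cannot be read off from the row
    sums, since the common factor (lambda y t)_oo may vanish.  Instead the k-th
    term is compared with the first entry of row k: their quotient is the
    product (y t / q^k)_k, which is bounded away from 0. *)
Lemma psi_generating_function (a b : list C) (q lambda x y t : C) :
  (Cmod q < 1)%R -> (forall beta, In beta b -> admissible q beta) ->
  q <> 0 -> y <> 0 -> t <> 0 ->
  (Cmod (y * t) < 1)%R -> admissible q (q / (y * t)) ->
  ex_series
    (fun n => Cmod (qpoch lambda q n * (t ^ n / qpoch q q n))
              * sum_n (fun k => Cmod (psi_term a b n x y q k)) n)%R ->
  ex_series (hyp_term (a ++ [lambda]) (b ++ [q / (y * t)]) q (x * q / y)) /\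
  is_series
    (fun n => qpoch lambda q n * psi a b n x y q * (t ^ n / qpoch q q n))
    (qpoch_inf (lambda * y * t) q / qpoch_inf (y * t) q
     * hyp_Phi (a ++ [lambda]) (b ++ [q / (y * t)]) q (x * q / y)).
Proof.
  intros Hq Hb Hq0 Hy Ht Hyt Hadm Habs.
  pose proof (Cmult_neq_0 _ _ Hy Ht) as Hyt0.
  set (d := triangle (srivastava_weight lambda q t)
              (fun n => psi_term a b n x y q)).
  assert (Hlt : forall k n, (n < k)%nat -> d k n = 0)
    by (intros; now apply triangle_lt).
  assert (Habs' : ex_series (fun n => sum_n (fun k => Cmod (d k n)) n)).
  { eapply ex_series_ext; [|exact Habs].
    intros n; symmetry; apply (sum_Cmod_triangle (srivastava_weight lambda q t)
      (fun n => psi_term a b n x y q)). }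
  destruct (qpoch_shifted_down_lower_bound q (y * t) Hq Hq0 Hyt0 Hadm)
    as [c [Hc Hcb]].
  assert (Hinf : forall k, qpoch_inf (y / q ^ k * t) q <> 0).
  { intros k; pose proof (Cpow_nz q k Hq0) as Hqk.
    replace (y / q ^ k * t) with (y * t / q ^ k) by (field; exact Hqk).
    rewrite (qpoch_inf_split _ q k Hq).
    replace (y * t / q ^ k * q ^ k) with (y * t) by (field; exact Hqk).
    apply Cmult_neq_0.
    - apply Cmod_gt_0; specialize (Hcb k); lra.
    - now apply qpoch_inf_neq_0, admissible_lt_1. }
  assert (Hhyp : ex_series (hyp_term (a ++ [lambda]) (b ++ [q / (y * t)]) q (x * q / y))).
  { apply ex_series_Cmod_le with
      (fun k => (/ c * sum_n (fun j => Cmod (d j k)) k)%R).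
    2:{ now apply (ex_series_scal_l (V := R_NormedModule) (/ c)%R). }
    intros k.
    assert (Hdk : d k k = qpoch (y * t / q ^ k) q k
      * hyp_term (a ++ [lambda]) (b ++ [q / (y * t)]) q (x * q / y) k).
    { rewrite <- (psi_row_factor a b q lambda x y t) by auto.
      unfold d; rewrite triangle_ge, psi_term_eq by auto.
      transitivity (row_factor q lambda (psi_coef a b q k) (x * t) k
        * (qbin_coef (lambda * q ^ k) q 0 * (y / q ^ k * t) ^ 0)).
      - rewrite <- row_term, Nat.add_0_r by assumption.
        unfold srivastava_weight; ring.
      - rewrite qbin_coef_0; simpl; ring. }
    assert (Hle : (Cmod (d k k) <= sum_n (fun j => Cmod (d j k)) k)%R)
      by now apply (Cmod_le_sum_n (fun j => d j k)).
    rewrite Hdk, Cmod_mult in Hle.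
    apply Rmult_le_reg_l with c; [exact Hc|].
    rewrite <- Rmult_assoc, Rinv_r, Rmult_1_l by lra.
    eapply Rle_trans; [|exact Hle].
    apply Rmult_le_compat_r; [apply Cmod_ge_0|apply Hcb]. }
  split; [exact Hhyp|].
  assert (Hrow : forall k, is_series (d k)
    (qpoch_inf (lambda * y * t) q / qpoch_inf (y * t) q
     * hyp_term (a ++ [lambda]) (b ++ [q / (y * t)]) q (x * q / y) k)).
  { intros k; apply psi_row; auto; now apply (ex_series_row d). }
  destruct (triangle_by_rows d _ Hlt Habs' Hrow) as [S [HS HR]].
  destruct Hhyp as [H HH].
  unfold hyp_Phi; rewrite (CSeries_unique _ _ HH).
  rewrite (is_series_C_unique _ _ _ (is_series_C_scal _ _ _ HH) HR).
  eapply is_series_C_ext; [|exact HS].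
  intros n; unfold d; rewrite sum_triangle.
  unfold srivastava_weight, psi; ring.
Qed.

Theorem theorem8 :
  forall (r : nat) (a b : list C) (q lambda x y : C),
    length a = S r -> length b = r ->
    (Cmod q < 1)%R ->
    (forall beta : C, In beta b -> admissible q beta) ->
    (* generating function for phi *)
    (forall t : C,
       (Cmod (y * t) < 1)%R ->
       admissible q (lambda * y * t) ->
       ex_series (hyp_term (a ++ [lambda]) (b ++ [lambda * y * t]) q (x * t)) ->
       is_series
         (fun n => qpoch lambda q n * phi a b n x y q * (t ^ n / qpoch q q n))
         (qpoch_inf (lambda * y * t) q / qpoch_inf (y * t) q
          * hyp_Phi (a ++ [lambda]) (b ++ [lambda * y * t]) q (x * t)))
    /\
    (* generating function for psi, as an identity of formal power series in t *)
    (q <> 0 -> y <> 0 ->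
       formal_sum_eq
         (fun n => qpoch lambda q n * psi a b n x y q / qpoch q q n)
         (fun k t =>
            qpoch_inf (lambda * y * t) q / qpoch_inf (y * t) q
            * hyp_term (a ++ [lambda]) (b ++ [q / (y * t)]) q (x * q / y) k))
    /\
    (* generating function for psi, at each t where the double series obtained
       by inserting the definition of psi converges absolutely *)
    (forall t : C,
       q <> 0 -> y <> 0 -> t <> 0 ->
       (Cmod (y * t) < 1)%R ->
       admissible q (q / (y * t)) ->
       ex_series
         (fun n => Cmod (qpoch lambda q n * (t ^ n / qpoch q q n))
                   * sum_n (fun k => Cmod (psi_term a b n x y q k)) n)%R ->
       ex_series (hyp_term (a ++ [lambda]) (b ++ [q / (y * t)]) q (x * q / y)) /\
       is_series
         (fun n => qpoch lambda q n * psi a b n x y q * (t ^ n / qpoch q q n))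
         (qpoch_inf (lambda * y * t) q / qpoch_inf (y * t) q
          * hyp_Phi (a ++ [lambda]) (b ++ [q / (y * t)]) q (x * q / y))).
Proof.
  intros r a b q lambda x y _ _ Hq Hb; repeat split.
  - intros t Hyt Hadm Hex; now apply phi_generating_function.
  - intros Hq0 Hy; now apply psi_formal_generating_function.
  - now apply (psi_generating_function a b q lambda x y t).
  - now apply (psi_generating_function a b q lambda x y t).
Qed.
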